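(* Let $\phi(x)=-\frac1{|x|}$, $x\in\mathbf{R}^{N}$, $\mathbf{x}=(t,x^\top)^\top$, $\mathbf{M}=\operatorname{diag}(-1,\mathrm{I}_{N})$, $\mathbf{A}(\mathbf{x})=(-\phi(x),0,\dots,0)^\top\in\mathbf{R}^{N+1}$, and $$\mathbb{L}^{\text{1st}}(\mathbf{x}_n,\mathbf{x}_{n+1},h)=\frac12\frac{(\mathbf{x}_{n+1}-\mathbf{x}_n)^\top\mathbf{M}(\mathbf{x}_{n+1}-\mathbf{x}_n)}{h^2}+\mathbf{A}^\top(\mathbf{x}_n)\frac{\mathbf{x}_{n+1}-\mathbf{x}_n}{h}.$$ Then the variational integrator deduced from the adjoint discrete Lagrangian $\mathbb{L}^*(\mathbf{x}_n,\mathbf{x}_{n+1},h)=\mathbb{L}^{\text{1st}}(\mathbf{x}_{n+1},\mathbf{x}_n,-h)$ is equal to $$\Phi_h^*=\phi_{H_t}^h\circ\phi_{H_1}^h\circ\cdots\circ\phi_{H_{N}}^h .$$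
   Context: This concerns the relativistic Kepler system in proper time $\tau$: $\frac{dt}{d\tau}=\gamma$, $\frac{dx}{d\tau}=u$, $\frac{d\gamma}{d\tau}=-\nabla\phi(x)\cdot u$, $\frac{du}{d\tau}=-\gamma\nabla\phi(x)$. The maps act on $(t,x,\gamma,u)$ with $x,u\in\mathbf{R}^N$, $\mathbf{e}_i$ the $i$-th standard basis vector of $\mathbf{R}^N$: $\phi_{H_t}^h:\ (t,x,\gamma,u)\mapsto(t+h\gamma,\ x,\ \gamma,\ u-h\gamma\nabla\phi(x))$; $\phi_{H_i}^h:\ (t,x,\gamma,u)\mapsto(t,\ x+hu_i\mathbf{e}_i,\ \gamma-[\phi(x+hu_i\mathbf{e}_i)-\phi(x)],\ u)$, $i=1,\dots,N$. Set $\Phi_h=\phi_{H_{N}}^h\circ\cdots\circ\phi_{H_1}^h\circ\phi_{H_t}^h$; the adjoint of a one-step method is $\Phi_h^*=(\Phi_{-h})^{-1}$. All points are assumed to avoid $x=0$. The variational integrator of a discrete Lagrangian $\mathbb{L}$ consists of the equations $\partial_1\mathbb{L}(\mathbf{x}_n,\mathbf{x}_{n+1},h)+\partial_2\mathbb{L}(\mathbf{x}_{n-1},\mathbf{x}_n,h)=0$. It equals a one-step map $\Psi_h$ in the following sense: with $\mathbf{v}_n=-h\frac{\partial\mathbb{L}(\mathbf{x}_n,\mathbf{x}_{n+1},h)}{\partial\mathbf{x}_n}-\mathbf{A}(\mathbf{x}_n)$ and $\mathbf{v}_{n+1}=h\frac{\partial\mathbb{L}(\mathbf{x}_n,\mathbf{x}_{n+1},h)}{\partial\mathbf{x}_{n+1}}-\mathbf{A}(\mathbf{x}_{n+1})$,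 and writing $\mathbf{v}_n=(-\gamma_n,u_n^\top)^\top$, these relations define precisely the map $(t_n,x_n,\gamma_n,u_n)\mapsto(t_{n+1},x_{n+1},\gamma_{n+1},u_{n+1})=\Psi_h(t_n,x_n,\gamma_n,u_n)$. *)

(* Defs.v *)
From HB Require Import structures.
From mathcomp Require Import all_boot all_order all_algebra.
From mathcomp Require Import all_classical all_reals all_analysis.

Set Implicit Arguments.
Unset Strict Implicit.
Unset Printing Implicit Defensive.

Import Order.TTheory GRing.Theory Num.Theory.
Import numFieldNormedType.Exports.
Local Open Scope ring_scope.

(* The library norm on 'cV[R]_n is the sup norm, hence this definition. *)
Definition euclidean_norm (R : realType) (n : nat) (x : 'cV[R]_n) : R :=
  Num.sqrt (\sum_(i < n) x i 0 ^+ 2).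

Definition grad (R : realType) (n : nat) (f : 'cV[R]_n -> R) (x : 'cV[R]_n) :
  'cV[R]_n := \col_(i < n) 'D_(delta_mx i 0) f x.

Definition potential (R : realType) (N : nat) (x : 'cV[R]_N) : R :=
  - (euclidean_norm x)^-1.

Record state (R : realType) (N : nat) := State {
  time : R;
  position : 'cV[R]_N;
  gam : R;
  velocity : 'cV[R]_N }.

(* The flows are total because 0^-1 = 0 in the library and because 'D is a
   total operator; their values where x = 0 have no mathematical content. *)
Definition flow_t (R : realType) (N : nat) (h : R) (z : state R N) :
    state R N :=
  let: State t x g u := z in
  State (t + h * g) x g (u - (h * g) *: grad (@potential R N) x).

Definition flow_i (R : realType) (N : nat) (i : 'I_N) (h : R)
    (z : state R N) : state R N :=
  let: State t x g u := z in
  let x' := x + (h * u i 0) *: delta_mx i 0 in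
  State t x' (g - (potential x' - potential x)) u.

(* flow_(N-1) o ... o flow_0 o flow_t *)
Definition splitting (R : realType) (N : nat) (h : R) (z : state R N) :
    state R N :=
  foldl (fun w i => flow_i i h w) (flow_t h z) (enum 'I_N).

(* flow_t o flow_0 o ... o flow_(N-1) *)
Definition splitting_rev (R : realType) (N : nat) (h : R) (z : state R N) :
    state R N :=
  flow_t h (foldr (fun i w => flow_i i h w) z (enum 'I_N)).

(* Psi_h = (Phi_{-h})^{-1} for every h, as a two-sided inverse. *)
Definition is_adjoint (R : realType) (S : Type) (Phi Psi : R -> S -> S) :
    Prop :=
  forall h : R, cancel (Phi (- h)) (Psi h) /\ cancel (Psi h) (Phi (- h)).

(* Points of space-time are column vectors (t, x^T)^T. *)
Definition spacetime (R : realType) (N : nat) (z : state R N) :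
  'cV[R]_(1 + N) := col_mx (time z)%:M (position z).

Definition space (R : realType) (N : nat) (X : 'cV[R]_(1 + N)) : 'cV[R]_N :=
  dsubmx X.

Definition four_velocity (R : realType) (N : nat) (z : state R N) :
  'cV[R]_(1 + N) := col_mx (- gam z)%:M (velocity z).

Definition minkowski (R : realType) (N : nat) : 'M[R]_(1 + N) :=
  block_mx (-1)%:M 0 0 1%:M.

Definition vector_potential (R : realType) (N : nat) (X : 'cV[R]_(1 + N)) :
  'cV[R]_(1 + N) := col_mx (- potential (space X))%:M 0.

Definition discrete_lagrangian (R : realType) (N : nat) : Type :=
  'cV[R]_(1 + N) -> 'cV[R]_(1 + N) -> R -> R.

Definition lagrangian_1st (R : realType) (N : nat) : discrete_lagrangian R N :=
  fun X Y h =>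
    1 / 2 * (((Y - X)^T *m minkowski R N *m (Y - X)) 0 0 / h ^+ 2)
    + ((vector_potential X)^T *m (h^-1 *: (Y - X))) 0 0.

Definition adjoint_lagrangian (R : realType) (N : nat)
    (L : discrete_lagrangian R N) : discrete_lagrangian R N :=
  fun X Y h => L Y X (- h).

Definition partial1 (R : realType) (N : nat) (L : discrete_lagrangian R N)
    (X Y : 'cV[R]_(1 + N)) (h : R) : 'cV[R]_(1 + N) :=
  grad (fun X' : 'cV[R]_(1 + N) => L X' Y h) X.

Definition partial2 (R : realType) (N : nat) (L : discrete_lagrangian R N)
    (X Y : 'cV[R]_(1 + N)) (h : R) : 'cV[R]_(1 + N) :=
  grad (fun Y' : 'cV[R]_(1 + N) => L X Y' h) Y.

Definition discrete_euler_lagrange (R : realType) (N : nat)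
    (L : discrete_lagrangian R N) (h : R) (X Y Z : 'cV[R]_(1 + N)) : Prop :=
  partial1 L Y Z h + partial2 L X Y h = 0.

Definition variational_step (R : realType) (N : nat)
    (L : discrete_lagrangian R N) (h : R) (z z' : state R N) : Prop :=
  let X := spacetime z in
  let Y := spacetime z' in
  four_velocity z = - (h *: partial1 L X Y h) - vector_potential X /\
  four_velocity z' = h *: partial2 L X Y h - vector_potential Y.

(* The variational integrator of L equals the one-step map Psi away from
   x = 0: the relations between (x_n, v_n) and (x_{n+1}, v_{n+1}) define the
   graph of Psi, and the solutions x_0, ..., x_K of the discrete
   Euler-Lagrange equations are the space-time parts of the orbits of Psi. *)
Definition variational_integrator_eq (R : realType) (N : nat)
    (L : discrete_lagrangian R N) (h : R) (Psi : state R N -> state R N) :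
    Prop :=
  (forall z z' : state R N, position z != 0 -> position z' != 0 ->
     (variational_step L h z z' <-> z' = Psi z)) /\
  (forall (K : nat) (X : nat -> 'cV[R]_(1 + N)),
     (forall n : nat, (n <= K)%N -> space (X n) != 0) ->
     ((forall n : nat, (0 < n < K)%N ->
         discrete_euler_lagrange L h (X n.-1) (X n) (X n.+1)) <->
      (exists z : nat -> state R N,
         (forall n : nat, (n <= K)%N -> spacetime (z n) = X n) /\
         (forall n : nat, (n < K)%N -> z n.+1 = Psi (z n))))).

(* Main.v *)
Require Import Defs.
From mathcomp Require Import all_boot all_order all_algebra.
From mathcomp Require Import all_classical all_reals all_analysis.
From mathcomp Require Import ring.

Set Implicit Arguments.
Unset Strict Implicit.
Unset Printing Implicit Defensive.

Import Order.TTheory GRing.Theory Num.Theory.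
Import numFieldNormedType.Exports.
Local Open Scope ring_scope.

(** The adjoint Lagrangian of the first order Lagrangian is
      L*(X, Y, h) = (|x' - x|^2 - (t' - t)^2) / (2 h^2)
                    - phi(x') (t' - t) / h      for X = (t, x), Y = (t', x'):
    the potential is now evaluated at the end point of the step.  Hence
    differentiating in X gives no gradient of phi, and the first relation of
    the integrator, v_n = - h d_1 L* - A(x_n), reads
      u = (x' - x) / h,    gamma = (t' - t) / h + phi(x') - phi(x),
    which is explicit in (t', x').  Differentiating in Y, the second relation
    reads
      gamma' = (t' - t) / h,    u' = (x' - x) / h - (t' - t) grad phi(x').
    Solved in the order x', gamma', t', u', these four equations are
      x' = x + h u,             gamma' = gamma - (phi(x') - phi(x)),
      t' = t + h gamma',        u' = u - h gamma' grad phi(x')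
    ([variational_step_Ladj]).

    On the side of the splitting, each flow of H_i leaves u unchanged, so the
    increments h u_i e_i add up to h u and the increments of gamma telescope
    to - (phi(x + h u) - phi(x)), whatever the order of the coordinates; the
    flow of H_t applied afterwards produces the same four formulas
    ([splitting_revE]).  That this composition is the adjoint holds because
    each flow at step - h is the inverse of the flow at step h, and inverting
    a composition reverses its order ([splitting_adjoint]).

    Finally, the discrete Euler-Lagrange equation at x_n says that the
    velocity v_n with which the step from x_n to x_{n+1} starts is the one
    with which the step from x_{n-1} to x_n ends, so for any discrete Lagrangian the one-step
    relations and the three-point recursion have the same space-time
    trajectories ([variational_integrator_of_step]).

    All derivatives are computed along lines, where they become derivatives
    of functions of one real variable. *)

(** * Directional derivatives and the Kepler potential *)

(** A directional derivative only sees the function on one line; in this form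
    the chain rule for functions of a real variable applies to it. *)
Lemma is_derive_line (R : realType) (V : normedModType R) (f : V -> R)
    (x v : V) (d : R) :
  is_derive x v f d <-> is_derive (0 : R) 1 (fun s : R => f (x + s *: v)) d.
Proof.
have E : (fun s : R => s^-1 *: ((f \o shift x) (s *: v) - f x)) =
   (fun s : R => s^-1 *: (((fun r : R => f (x + r *: v)) \o shift 0)
      (s *: (1 : R)) - f (x + (0 : R) *: v))).
  by apply: funext => s /=; rewrite scale0r !addr0 [s%:A]mulr1 (addrC x).
by split=> -[]; rewrite /derivable /derive => dv <-; apply: DeriveDef;
  rewrite /derivable /derive ?E -?E // in dv *.
Qed.

Section Potential.
Variables (R : realType) (N : nat).
Implicit Types x v : 'cV[R]_N.

Definition dot x v : R := \sum_(i < N) x i 0 * v i 0.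

(** The form under which a squared norm restricted to a line is
    differentiated by [is_derive_poly2]. *)
Lemma dot_line x v (s : R) :
  dot (x + s *: v) (x + s *: v) =
  dot x x + s * (2 * dot x v) + s ^+ 2 * dot v v.
Proof.
rewrite /dot !mulr_sumr -!big_split /=; apply: eq_bigr => i _.
by rewrite !mxE; ring.
Qed.

Lemma dot_gt0 x : x != 0 -> 0 < dot x x.
Proof.
move=> x0; have dge0 i : true -> 0 <= x i 0 * x i 0 by rewrite -expr2 sqr_ge0.
rewrite lt_def sumr_ge0 // andbT psumr_neq0 //; apply: contraNT x0.
move=> /hasPn x0; apply/eqP/colP => i; rewrite mxE.
have := x0 i (mem_index_enum i).
by rewrite /= -expr2 lt_def sqr_ge0 andbT negbK sqrf_eq0 => /eqP.
Qed.

Lemma dot0 x : dot x 0 = 0.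
Proof. by rewrite /dot big1 // => i _; rewrite mxE mulr0. Qed.

Lemma dot_delta x i : dot x (delta_mx i 0) = x i 0.
Proof.
rewrite /dot (bigD1 i) //= big1 => [|j ji].
  by rewrite !mxE !eqxx mulr1 addr0.
by rewrite !mxE (negPf ji) mulr0.
Qed.

Lemma is_derive_poly2 (a b c : R) :
  is_derive (0 : R) 1 (fun s : R => a + s * b + s ^+ 2 * c) b.
Proof.
apply: is_derive_eq.
by rewrite /GRing.scale /=; ring.
Qed.

(** Along a line the squared norm is a quadratic polynomial; where it is
    positive, the square root and then the inverse are differentiable. *)
Lemma derivable_potential x v : x != 0 -> derivable (@potential R N) x v.
Proof.
move=> /dot_gt0 x0.
have H0 : dot (x + (0 : R) *: v) (x + (0 : R) *: v) = dot x x.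
  by rewrite scale0r addr0.
have H : is_derive (0 : R) 1 (fun s => dot (x + s *: v) (x + s *: v))
     (2 * dot x v).
  rewrite (_ : (fun _ => _) =
    (fun s : R => dot x x + s * (2 * dot x v) + s ^+ 2 * dot v v)).
    exact: is_derive_poly2.
  by apply: funext => s; rewrite dot_line.
have {}H : is_derive (0 : R) 1
    (fun s => Num.sqrt (dot (x + s *: v) (x + s *: v)))
    ((2 * Num.sqrt (dot x x))^-1 * (2 * dot x v)).
  apply: (is_derive1_comp (f := @Num.sqrt R)) => /=.
  by rewrite H0; apply: is_derive1_sqrt.
set n := fun s : R => Num.sqrt (dot (x + s *: v) (x + s *: v)) in H.
have n0 : n 0 != 0 by rewrite /n H0 sqrtr_eq0 -ltNge.
have {}H := is_deriveN (is_deriveV n0 H).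
by case: (iffRL (is_derive_line (@potential R N) x v _) H).
Qed.
End Potential.

(** * The splitting method and its adjoint *)

Section Splitting.
Variables (R : realType) (N : nat).
Implicit Types (h t g : R) (x u : 'cV[R]_N) (z : state R N).

(** The flow of H_t leaves x and gamma unchanged, and the increments of t and
    u depend only on these and are odd in h. *)
Lemma flow_tK h : cancel (@flow_t R N (- h)) (@flow_t R N h).
Proof.
case=> t x g u; rewrite /flow_t; congr State; first by ring.
by rewrite !mulNr scaleNr opprK addrK.
Qed.

(** The flow of H_i never changes u, so going back by h u_i along e_i
    recovers the position, and the potential difference that enters gamma only
    changes sign. *)
Lemma flow_iK i h : cancel (@flow_i R N i (- h)) (@flow_i R N i h).
Proof.
case=> t x g u; rewrite /flow_i.
have -> : x + (- h * u i 0) *: delta_mx i 0 + (h * u i 0) *: delta_mx i 0 = x.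
  by rewrite mulNr scaleNr subrK.
by congr State; ring.
Qed.

(** [foldl] applies the maps from the head of the list and [foldr] from its
    end, so each undoes the other, last map first. *)
Lemma foldl_foldr_cancel (T S : Type) (f g : T -> S -> S) (s : seq T) :
  (forall i, cancel (f i) (g i)) ->
  cancel (fun w => foldl (fun w i => f i w) w s)
         (fun w => foldr g w s).
Proof. by move=> fK; elim: s => [|i s IHs] w //=; rewrite IHs fK. Qed.

Lemma foldr_foldl_cancel (T S : Type) (f g : T -> S -> S) (s : seq T) :
  (forall i, cancel (g i) (f i)) ->
  cancel (fun w => foldr g w s)
         (fun w => foldl (fun w i => f i w) w s).
Proof. by move=> gK; elim: s => [|i s IHs] w //=; rewrite gK IHs. Qed.

Lemma splitting_adjoint : is_adjoint (@splitting R N) (@splitting_rev R N).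
Proof.
move=> h; split=> z; rewrite /splitting /splitting_rev.
  rewrite (foldl_foldr_cancel _ (fun i => @flow_iK i h)).
  exact: flow_tK.
have tK : cancel (@flow_t R N h) (@flow_t R N (- h)).
  by rewrite -{1}[h]opprK; apply: flow_tK.
have iK i : cancel (@flow_i R N i h) (@flow_i R N i (- h)).
  by rewrite -{1}[h]opprK; apply: flow_iK.
by rewrite tK (foldr_foldl_cancel _ iK).
Qed.

(** Since u is constant along these flows, the position increments do not
    interact, and the potential differences telescope. *)
Lemma foldr_flow_i h t x g u (s : seq 'I_N) :
  let y := x + \sum_(i <- s) (h * u i 0) *: delta_mx i 0 in
  foldr (fun i w => flow_i i h w) (State t x g u) s =
  State t y (g - (potential y - potential x)) u.
Proof.
elim: s => [|i s IHs] /=; first by rewrite big_nil addr0 subrr subr0.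
rewrite IHs big_cons /flow_i.
set y := x + \sum_(j <- s) _.
have -> : y + (h * u i 0) *: delta_mx i 0 =
    x + ((h * u i 0) *: delta_mx i 0 +
         \sum_(j <- s) (h * u j 0) *: delta_mx j 0).
  by rewrite [in RHS]addrC addrAC [RHS]addrC addrA.
by congr State; ring.
Qed.

(** Both t and u are updated with the new value of gamma, and u with the
    gradient at the new position, because the flow of H_t comes last. *)
Lemma splitting_revE h t x g u :
  let y := x + h *: u in
  let g' := g - (potential y - potential x) in
  splitting_rev h (State t x g u) =
  State (t + h * g') y g' (u - (h * g') *: grad (@potential R N) y).
Proof.
rewrite /splitting_rev foldr_flow_i /=.
have -> : \sum_(i <- enum 'I_N) (h * u i 0) *: delta_mx i 0 = h *: u.
  rewrite big_enum [u in RHS]matrix_sum_delta scaler_sumr.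
  by apply: eq_bigr => i _; rewrite big_ord1 scalerA.
by [].
Qed.
End Splitting.

(** * The adjoint discrete Lagrangian and its derivatives *)

Section Lagrangian.
Variables (R : realType) (N : nat).
Notation Ladj := (adjoint_lagrangian (@lagrangian_1st R N)).
Notation pt a v := (col_mx (a%:M : 'M[R]_1) v : 'cV[R]_(1 + N)).

Lemma pt_surj (X : 'cV[R]_(1 + N)) : X = pt (X (lshift N 0) 0) (dsubmx X).
Proof.
rewrite -[LHS]vsubmxK; congr col_mx; apply/matrixP => i j.
by rewrite !mxE !ord1.
Qed.

Lemma pt_inj (a b : R) (v w : 'cV[R]_N) : pt a v = pt b w <-> a = b /\ v = w.
Proof.
split=> [/eq_col_mx[] /matrixP/(_ 0 0)|[-> ->] //].
by rewrite !mxE.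
Qed.

Lemma pt_line (a b s : R) (v w : 'cV[R]_N) :
  pt a v + s *: pt b w = pt (a + s * b) (v + s *: w).
Proof.
by rewrite scale_col_mx add_col_mx scale_scalar_mx raddfD.
Qed.

Lemma minkowski_pt (a b : R) (v w : 'cV[R]_N) :
  ((pt a v)^T *m Defs.minkowski R N *m pt b w) 0 0 = dot v w - a * b.
Proof.
rewrite /Defs.minkowski tr_col_mx mul_row_block mul_row_col.
rewrite !mulmx0 add0r addr0 mulmx1 tr_scalar_mx -!scalar_mxM mulrN1 mulNr.
rewrite addrC !mxE; congr (_ - _).
by apply: eq_bigr => i _; rewrite mxE.
Qed.

Lemma vector_potential_pt (a b : R) (x v : 'cV[R]_N) :
  ((vector_potential (pt a x))^T *m pt b v) 0 0 = - potential x * b.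
Proof.
rewrite /vector_potential /Defs.space col_mxKd tr_col_mx mul_row_col trmx0.
by rewrite mul0mx addr0 tr_scalar_mx -scalar_mxM mxE.
Qed.

(** Reversing the step changes the sign of both the displacement and h, so the
    only effect of taking the adjoint is to move the evaluation point of the
    potential to the end of the step. *)
Lemma Ladj_pt (h t t' : R) (x x' : 'cV[R]_N) :
  Ladj (pt t x) (pt t' x') h =
  1 / 2 * ((dot (x' - x) (x' - x) - (t' - t) ^+ 2) / h ^+ 2)
  - potential x' * (t' - t) / h.
Proof.
have Epm : pt t x - pt t' x' = pt (t - t') (x - x').
  by rewrite opp_col_mx add_col_mx -raddfB.
rewrite /adjoint_lagrangian /lagrangian_1st Epm minkowski_pt.
rewrite scale_col_mx scale_scalar_mx vector_potential_pt sqrrN invrN.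
have -> : dot (x - x') (x - x') = dot (x' - x) (x' - x).
  by apply: eq_bigr => i _; rewrite !mxE; ring.
by ring.
Qed.

(** In its first argument the adjoint Lagrangian is a quadratic polynomial:
    the potential does not see X. *)
Lemma is_derive_Ladj1 (h t t' b : R) (x x' w : 'cV[R]_N) : h != 0 ->
  is_derive (pt t x) (pt b w) (fun X => Ladj X (pt t' x') h)
    (h ^- 2 * ((t' - t) * b - dot (x' - x) w) + potential x' * b / h).
Proof.
move=> h0; apply/is_derive_line.
rewrite (_ : (fun _ => _) = (fun s : R => Ladj (pt t x) (pt t' x') h
   + s * (h ^- 2 * ((t' - t) * b - dot (x' - x) w) + potential x' * b / h)
   + s ^+ 2 * (1 / 2 * (dot w w - b ^+ 2) / h ^+ 2))); last first.
  apply: funext => s; rewrite pt_line !Ladj_pt.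
  have -> : x' - (x + s *: w) = (x' - x) + (- s) *: w.
    by rewrite scaleNr opprD addrA.
  by rewrite dot_line; field; rewrite h0.
exact: is_derive_poly2.
Qed.

(** The direction is a general (b, w), with the derivative [d] of the potential
    along [w] as a parameter, so that the time direction (where [w] = 0) and the
    space directions are handled at once. *)
Lemma is_derive_Ladj2 (h t t' b d : R) (x x' w : 'cV[R]_N) : h != 0 ->
  is_derive x' w (@potential R N) d ->
  is_derive (pt t' x') (pt b w) (fun Y => Ladj (pt t x) Y h)
    (h ^- 2 * (dot (x' - x) w - (t' - t) * b)
     - (potential x' * b + (t' - t) * d) / h).
Proof.
move=> h0 /is_derive_line dphi; apply/is_derive_line.
set p := fun s : R => potential (x' + s *: w) in dphi.
have p0 : p 0 = potential x' by rewrite /p scale0r addr0.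
rewrite (_ : (fun _ => _) = (fun s : R =>
    (1 / 2 * ((dot (x' - x) (x' - x) - (t' - t) ^+ 2) / h ^+ 2)
    + s * (h ^- 2 * (dot (x' - x) w - (t' - t) * b))
    + s ^+ 2 * (1 / 2 * (dot w w - b ^+ 2) / h ^+ 2))
   - h^-1 * (p s * ((t' - t) + s * b + s ^+ 2 * 0)))); last first.
  apply: funext => s; rewrite pt_line !Ladj_pt -/(p s).
  have -> : x' + s *: w - x = (x' - x) + s *: w by rewrite addrAC.
  by rewrite dot_line; field; rewrite h0.
(* The zero coefficient turns the affine factor into an instance of the
   quadratic case. *)
have dt := is_derive_poly2 (t' - t) b 0.
have dquad := is_derive_poly2
  (1 / 2 * ((dot (x' - x) (x' - x) - (t' - t) ^+ 2) / h ^+ 2))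
  (h ^- 2 * (dot (x' - x) w - (t' - t) * b))
  (1 / 2 * (dot w w - b ^+ 2) / h ^+ 2).
by apply: is_derive_eq; rewrite p0 /GRing.scale /=; ring.
Qed.

Lemma delta_time : delta_mx (lshift N 0) 0 = pt 1 0.
Proof.
rewrite delta_mx_ushift; congr col_mx; apply/matrixP => i j.
by rewrite !mxE !ord1.
Qed.

Lemma delta_space (i : 'I_N) : delta_mx (rshift 1 i) 0 = pt 0 (delta_mx i 0).
Proof. by rewrite delta_mx_dshift raddf0. Qed.

Lemma partial1_Ladj (h t t' : R) (x x' : 'cV[R]_N) : h != 0 ->
  partial1 Ladj (pt t x) (pt t' x') h =
  pt (h ^- 2 * (t' - t) + potential x' / h) (- (h ^- 2 *: (x' - x))).
Proof.
move=> h0; apply/colP => k; rewrite mxE.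
have [i|i] := split_ordP k => ->.
  rewrite ord1 delta_time col_mxEu.
  have [_ ->] := is_derive_Ladj1 t t' 1 x x' 0 h0.
  by rewrite dot0 !mxE eqxx mulr1n; ring.
rewrite delta_space col_mxEd.
have [_ ->] := is_derive_Ladj1 t t' 0 x x' (delta_mx i 0) h0.
by rewrite dot_delta !mxE; ring.
Qed.

Lemma is_derive_dir0 (V : normedModType R) (f : V -> R) (x : V) :
  is_derive x 0 f 0.
Proof.
apply/is_derive_line; under eq_fun do rewrite scaler0 addr0.
exact: is_derive_cst.
Qed.

Lemma partial2_Ladj (h t t' : R) (x x' : 'cV[R]_N) : h != 0 -> x' != 0 ->
  partial2 Ladj (pt t x) (pt t' x') h =
  pt (- (h ^- 2 * (t' - t)) - potential x' / h)
     (h ^- 2 *: (x' - x) - ((t' - t) / h) *: grad (@potential R N) x').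
Proof.
move=> h0 x'0; apply/colP => k; rewrite mxE.
have [i|i] := split_ordP k => ->.
  rewrite ord1 delta_time col_mxEu.
  have D0 := is_derive_dir0 (@potential R N) x'.
  have [_ ->] := is_derive_Ladj2 t t' 1 x h0 D0.
  by rewrite dot0 !mxE eqxx mulr1n; ring.
rewrite delta_space col_mxEd.
have Di : is_derive x' (delta_mx i 0) (@potential R N)
    (grad (@potential R N) x' i 0).
  by apply: DeriveDef; [exact: derivable_potential | rewrite mxE].
have [_ ->] := is_derive_Ladj2 t t' 0 x h0 Di.
by rewrite dot_delta !mxE; ring.
Qed.

(** The space part of the first relation gives x'.  The time part of the second
    one is gamma' = (t' - t) / h: the terms in phi(x') cancel there.  It turns
    the time part of the first relation into an explicit formula for gamma', from
    which t' and u' follow. *)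
Lemma variational_step_Ladj (h : R) (z z' : state R N) :
  h != 0 -> position z' != 0 ->
  variational_step Ladj h z z' <-> z' = splitting_rev h z.
Proof.
case: z z' => [t x g u] [t' x' g' u'] h0 /= x'0.
rewrite /variational_step /spacetime /four_velocity /vector_potential.
rewrite /Defs.space /= !col_mxKd partial1_Ladj // partial2_Ladj //.
rewrite !scale_col_mx !opp_col_mx !add_col_mx !scale_scalar_mx.
rewrite -!(raddfN (@scalar_mx R 1)) /= -!raddfD /= !oppr0 !addr0.
rewrite (scalerN h (_ *: (x' - x))) (opprK (h *: _)).
rewrite (scalerBr h (_ *: (x' - x))) !scalerA.
have -> : h * h ^- 2 = h^-1 by field.
have -> : h * ((t' - t) / h) = t' - t by field.
rewrite splitting_revE; split.
  move=> [/pt_inj[Eg Eu] /pt_inj[Eg' Eu']].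
  have Ex : x' = x + h *: u.
    by rewrite Eu scalerA divff // scale1r addrC subrK.
  have Et' : g' = (t' - t) / h.
    by apply: oppr_inj; rewrite Eg'; field.
  have {}Eg : g' = g - (potential x' - potential x).
    by rewrite -[g]opprK Eg Et'; field.
  have Et : h * g' = t' - t by rewrite Et'; field.
  by rewrite -Ex -Eg Et Eu' -Eu; congr State; ring.
move=> [Et Ex Eg Eu].
rewrite -Ex in Eg Et Eu; rewrite -Eg in Et Eu.
have Edx : h^-1 *: (x' - x) = u.
  by rewrite Ex addrC addKr scalerA mulVf // scale1r.
have Edt : t' - t = h * g' by rewrite Et addrC addKr.
by rewrite Edx Edt; split; apply/pt_inj; split=> //; rewrite Eg; field.
Qed.

(** * From one-step relations to discrete trajectories *)

Definition state_of (X V : 'cV[R]_(1 + N)) : state R N :=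
  State (X (lshift N 0) 0) (dsubmx X) (- V (lshift N 0) 0) (dsubmx V).

Lemma spacetime_state_of X V : spacetime (state_of X V) = X.
Proof. by rewrite [RHS]pt_surj. Qed.

Lemma four_velocity_state_of X V : four_velocity (state_of X V) = V.
Proof. by rewrite [RHS]pt_surj /four_velocity /state_of /= opprK. Qed.

(** A trajectory of the three-point recursion carries no velocities: they are
    recovered from the step that leaves each point.  The equation at x_n makes
    this choice agree with the velocity delivered by the step arriving at x_n,
    which is what a one-step relation requires.  Conversely, consecutive steps
    of an orbit share the velocity at x_n, and equating its two expressions
    gives h times the equation at x_n. *)
Lemma variational_integrator_of_step (L : discrete_lagrangian R N) (h : R)
    (Psi : state R N -> state R N) :
  h != 0 ->
  (forall z z', position z != 0 -> position z' != 0 ->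
     (variational_step L h z z' <-> z' = Psi z)) ->
  variational_integrator_eq L h Psi.
Proof.
move=> h0 stepP; split=> // K X X0; split=> [DEL|[z [zX zPsi]] n /andP[n0 nK]].
  pose vout n := - (h *: partial1 L (X n) (X n.+1) h) - vector_potential (X n).
  pose vin n := h *: partial2 L (X n.-1) (X n) h - vector_potential (X n).
  (* No step leaves the last point, whose velocity is therefore that of the
     arriving step. *)
  pose z n := state_of (X n) (if (n < K)%N then vout n else vin n).
  have zX n : spacetime (z n) = X n by rewrite spacetime_state_of.
  exists z; split=> // n nK.
  apply/stepP; [exact/X0/ltnW | exact: X0 |].
  rewrite /variational_step !zX !four_velocity_state_of nK; split=> //.
  (* The departing velocity at an interior point must equal the arriving one. *)
  case: ifP => // n1K; rewrite /vout /vin; congr (_ - _).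
  apply/eqP; rewrite eq_sym -addr_eq0 -scalerDr addrC.
  by rewrite scaler_eq0 (DEL n.+1) ?eqxx ?orbT.
have pos0 m : (m <= K)%N -> position (z m) != 0.
  by move=> mK; have := X0 m mK; rewrite -zX // /Defs.space col_mxKd.
have step m : (m < K)%N -> variational_step L h (z m) (z m.+1).
  by move=> mK; apply/stepP; [exact/pos0/ltnW | exact: pos0 | exact: zPsi].
have [vout _] := step n nK.
have [_ vin] := step n.-1 (leq_ltn_trans (leq_pred n) nK).
rewrite prednK // in vin.
have n1K : (n.-1 <= K)%N by rewrite (leq_trans (leq_pred n)) // ltnW.
rewrite !zX // 1?ltnW // in vin vout; move: vin; rewrite vout => /addIr.
move=> /eqP; rewrite eq_sym -addr_eq0 -scalerDr addrC.
by rewrite scaler_eq0 (negPf h0) => /eqP.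
Qed.
End Lagrangian.

(** * The variational integrator is the adjoint splitting *)

Theorem theorem3p6 (R : realType) (N : nat) :
  is_adjoint (@splitting R N) (@splitting_rev R N) /\
  (forall h : R, h != 0 ->
     variational_integrator_eq (adjoint_lagrangian (@lagrangian_1st R N)) h
       (@splitting_rev R N h)).
Proof.
split=> [|h h0]; first exact: splitting_adjoint.
apply: variational_integrator_of_step => // z z' _ z'0.
exact: variational_step_Ladj.
Qed.
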